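(* Let $s,n\ge1$ be integers with $\gcd(s,n)=1$ and $n\ge 2s+1$. Then, as $m\ge 1$ ranges over all positive integers and $\phi$ over all phases for which $Z(s,n,m,\phi)$ is a cylinder knot, there are at most $(n+1)2^{s-3}$ cylinder braids with parameters $s,n$, where rotated and mirrored braids are identified.
   Context: Let $g(t)=2\,|t-\lfloor t\rfloor-\tfrac12|$ be the sawtooth function. For integers $s,n,m\ge1$ with $\gcd(s,n)=1$, $n\ge 2s+1$ and $\phi\in\mathbb R$, the billiard curve $Z(s,n,m,\phi)$ in the cylinder $D^2\times I=\{(z,x)\in\mathbb C\times\mathbb R:|z|\le1,\ 0\le x\le1\}$ is the closed curve $t\mapsto (f_{1,2}(t),f_3(t))$, $t\in[0,1]$, where $f_{1,2}$ is the piecewise linear map, affine on each $[k/n,(k+1)/n]$, with $f_{1,2}(k/n)=e^{2\pi i sk/n}$, and $f_3(t)=g(mt+\phi)$. It is called a cylinder knot if it has no self-intersections and no vertex on the circles $\partial D^2\times\{0,1\}$. Cylinder braids. The projected curve $f_{1,2}$ runs counterclockwise around $0$ and has exactly $n(s-1)$ crossings, lying on $s-1$ concentric circles with $n$ equally spaced crossings on each. Number these circles $j=1,\ldots,s-1$ from the outside inward; let $(i,j)$, $i\in\mathbb Z/n\mathbb Z$, be the crossing on circle $j$ at angle $(2i-1)\pi/n$ if $j$ is odd and $2i\pi/n$ if $j$ is even. Reading a cylinder knot counterclockwise as a closed braid on $s$ strings gives $$\Bigl[\prod_{i=1}^n\ \prod_{j\text{ odd},\,j<s}\sigma_j^{\varepsilon_{i,j}}\prod_{j\text{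 even},\,j<s}\sigma_j^{\varepsilon_{i,j}}\Bigr]^{\widehat{}},\qquad \varepsilon_{i,j}\in\{\pm1\},$$ where $\varepsilon_{i,j}=+1$ if at crossing $(i,j)$ the left string (the one coming from the side of the center) has greater height $f_3$ than the right string, and $\varepsilon_{i,j}=-1$ otherwise. The braid given by this word (equivalently, by the sign array $(\varepsilon_{i,j})$) is the cylinder braid of $Z(s,n,m,\phi)$. Two cylinder braids are identified if one is obtained from the other by a symmetry of the cylinder preserving the projected curve, i.e. by a composition of rotations about the central axis through multiples of $2\pi/n$, reflections in vertical symmetry planes of the projected curve through the central axis, and the reflection $x\mapsto1-x$. *)

(* Defs.v *)
From HB Require Import structures.
From mathcomp Require Import all_boot all_order all_algebra.
From mathcomp Require Import all_classical all_reals all_analysis.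
From mathcomp Require Import complex.

Set Implicit Arguments.
Unset Strict Implicit.
Unset Printing Implicit Defensive.

Import Order.TTheory GRing.Theory Num.Theory.
Import numFieldNormedType.Exports.

Local Open Scope classical_set_scope.
Local Open Scope ring_scope.

Section Curve.
Context {R : realType}.

Definition sawtooth (t : R) : R := 2 * `|t - (Num.floor t)%:~R - 2^-1|.

Definition cis (a : R) : R[i] := (cos a +i* sin a)%C.

Definition modulus (z : R[i]) : R := ComplexField.Normc.normc z.

Definition vertex (s n : nat) (k : int) : R[i] :=
  cis (2 * pi * s%:R * k%:~R / n%:R).

(* On [k/n, (k+1)/n] the integer part of n * t is k and its fractional part w
   is the barycentric coordinate along the edge from vertex k to vertex k + 1;
   at t = (k+1)/n the formula gives vertex k + 1, as it should. *)
Definition proj_curve (s n : nat) (t : R) : R[i] :=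
  let k := Num.floor (n%:R * t) in
  let w := n%:R * t - k%:~R in
  (1 - w)%:C%C * vertex s n k + w%:C%C * vertex s n (k + 1).

Definition height (m : nat) (phi t : R) : R := sawtooth (m%:R * t + phi).

Definition billiard_curve (s n m : nat) (phi t : R) : R[i] * R :=
  (proj_curve s n t, height m phi t).

(* The curve is closed, so the absence of self-intersections is injectivity on
   the half-open parameter interval [0, 1[. Its points on the lateral boundary
   of the cylinder are those with parameter k/n. *)
Definition cylinder_knot (s n m : nat) (phi : R) : Prop :=
  {in `[0, 1[ &, injective (billiard_curve s n m phi)} /\
  forall k : nat, (k < n)%N ->
    height m phi (k%:R / n%:R) != 0 /\ height m phi (k%:R / n%:R) != 1.

Definition double_pt (s n : nat) (t u : R) : Prop :=
  [/\ t \in `[0, 1[, u \in `[0, 1[, t != u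
    & proj_curve s n t = proj_curve s n u].

Definition crossing (s n : nat) : set R[i] :=
  [set P | exists t u, double_pt s n t u /\ proj_curve s n t = P].

Definition crossing_radii (s n : nat) : set R := modulus @` crossing s n.

(* The crossings lie on s - 1 circles, numbered from the outside inward. The
   index j : 'I_s.-1 stands for circle number j + 1, that is, the one with
   exactly j circles of crossings outside it. *)
Definition on_circle (s n : nat) (j : 'I_s.-1) (P : R[i]) : Prop :=
  crossing s n P /\
  ([set r | crossing_radii s n r /\ modulus P < r] #= `I_j)%card.

(* Circle number j + 1 is odd when j is even. The angle is only relevant modulo
   2 * pi, so that any representative of i modulo n may be used. *)
Definition crossing_angle (n : nat) (i : 'Z_n) (j : nat) : R :=
  (if odd j.+1 then 2 * i%:R - 1 else 2 * i%:R) * pi / n%:R.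

Definition is_crossing (s n : nat) (i : 'Z_n) (j : 'I_s.-1) (P : R[i]) : Prop :=
  on_circle n j P /\ P = (modulus P)%:C%C * cis (crossing_angle i j).

(* t and u are the parameters of the left and of the right string at crossing
   (i, j): just before t the curve is nearer to the center. *)
Definition left_right (s n : nat) (i : 'Z_n) (j : 'I_s.-1) (t u : R) : Prop :=
  [/\ double_pt s n t u, is_crossing i j (proj_curve s n t)
    & \forall v \near t^'-,
        modulus (proj_curve s n v) < modulus (proj_curve s n t)].

End Curve.

(* Indexed by the crossings (i, j); true stands for +1 and false for -1. *)
Definition sign_array (s n : nat) := {ffun 'Z_n * 'I_s.-1 -> bool}.

Definition cylinder_braid (R : realType) (s n m : nat) (phi : R) :
    sign_array s n :=
  [ffun c => `[< exists t u : R,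
     left_right c.1 c.2 t u /\ height m phi u < height m phi t >]].

Definition cylinder_braids (R : realType) (s n : nat) : {set sign_array s n} :=
  [set e : sign_array s n | `[< exists (m : nat) (phi : R),
     [/\ (0 < m)%N, cylinder_knot s n m phi & e = cylinder_braid s n m phi] >]]%SET.

Section Symmetries.
Context (s n : nat).

Definition rotate (k : 'Z_n) (e : sign_array s n) : sign_array s n :=
  [ffun c => e (c.1 + k, c.2)].

(* Reflection in the vertical plane at angle k * pi / n: it maps the angle a to
   2 * k * pi / n - a, and hence crossing i to k + 1 - i on the odd-numbered
   circles and to k - i on the even-numbered ones. The reflected curve runs
   clockwise; reading it counterclockwise reverses it, which interchanges the
   left and the right string at every crossing and so negates the signs. *)
Definition mirror (k : 'Z_n) (e : sign_array s n) : sign_array s n :=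
  [ffun c : 'Z_n * 'I_s.-1 =>
    ~~ e ((if odd c.2.+1 then k + 1 - c.1 else k - c.1), c.2)].

(* The reflection x |-> 1 - x exchanges over- and undercrossings. *)
Definition flip (e : sign_array s n) : sign_array s n := [ffun c => ~~ e c].

Definition symmetry_step : rel (sign_array s n) := fun e e' =>
  [|| [exists k, e' == rotate k e], [exists k, e' == mirror k e]
    | e' == flip e].

(* Each of the generating symmetries has its inverse among them, so that their
   reflexive transitive closure is an equivalence relation. *)
Definition braid_equiv : rel (sign_array s n) := connect symmetry_step.

End Symmetries.

Definition num_cylinder_braids (R : realType) (s n : nat) : nat :=
  #|equivalence_partition (@braid_equiv s n) (cylinder_braids R s n)|.

(* Main.v *)
(** Edges [a] and [b] of the star polygon cross exactly when [s (b - a)] is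
    congruent modulo [n] to some [D] with [0 < |D| < s], and circle number
    [s - |D|] carries these crossings. As the sawtooth is a monotone
    function of [cos (2 pi x)], the sign at a crossing with parameters [t], [u]
    is governed by
      [cos (2 pi y) - cos (2 pi x) = 2 sin (pi (x + y)) sin (pi (x - y))],
    [x = m t + phi], [y = m u + phi]. The factor in [x - y] depends only on the
    circle. The other one is a square wave in the angle of the crossing:
    writing [r s = 1] modulo [n] and [M = m r], its sign at the crossing of
    angle [X pi / n] is the parity of the floor of [(M X + p) / n], for an
    integer phase [p]. So the sign array is determined by [M], [p] and one
    sign per circle.

    Rotations add multiples of [2 M] to [p], adding [n] to [p] changes all
    signs, and a mirror image replaces [p] by [- p - 1]; a Bezout argument then
    reduces [p] to [0]. Changing [M] to [M + n] or to [- M] only affects the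
    signs of the circles, so [0 <= M <= n / 2] suffices, and the flip fixes the
    sign of the outermost circle: this leaves [2 ^ (s - 2)] classes for each
    [M]. If [n] is even and [M = n / 2], a mirror image changes exactly the
    signs of the even-numbered circles, which halves the count once more and
    gives [(n + 1) 2 ^ (s - 3)] in both parities. *)

Require Import Defs.
From mathcomp Require Import all_boot all_order all_algebra.
From mathcomp Require Import all_classical all_reals all_analysis.
From mathcomp Require Import complex.
From mathcomp Require Import zify ring lra.

Set Implicit Arguments.
Unset Strict Implicit.
Unset Printing Implicit Defensive.

Import Order.TTheory GRing.Theory Num.Theory.
Import numFieldNormedType.Exports.

Local Open Scope ring_scope.
(** * Square waves on the crossings *)

Definition oddz (z : int) : bool := (z %% 2)%Z == 1.

Lemma oddzD a b : oddz (a + b) = oddz a (+) oddz b.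
Proof. rewrite /oddz; lia. Qed.

Lemma oddz_nat (k : nat) : oddz k = odd k.
Proof. rewrite /oddz; lia. Qed.

Lemma oddzM2 a : oddz (2 * a) = false.
Proof. rewrite /oddz; lia. Qed.

Lemma oddzN a : oddz (- a) = oddz a.
Proof. rewrite /oddz; lia. Qed.

(** Writing z = q d + r gives - z - 1 = - (q + 1) d + (d - 1 - r), so the quotient turns into - q -
    1, of the opposite parity. *)
Lemma oddz_divN (z d : int) : 0 < d -> oddz ((- z - 1) %/ d)%Z = ~~ oddz (z %/ d)%Z.
Proof.
move=> d0; have dn0 : d != 0 by lia.
have := modz_ge0 z dn0; have := ltz_pmod z d0; have := divz_eq z d.
move: (z %/ d)%Z (z %% d)%Z => q r -> rd r0.
have -> : - (q * d + r) - 1 = (- (q + 1)) * d + (d - 1 - r) by ring.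
rewrite divzMDl // divz_small ?addr0; last lia.
by rewrite oddzN /oddz; lia.
Qed.

Lemma Zp_natD n (a b : 'Z_n) : (1 < n)%N ->
  {q : int | (nat_of_ord (a + b))%:Z = (nat_of_ord a)%:Z + (nat_of_ord b)%:Z - n%:Z * q}.
Proof.
case: n a b => [//|[//|n]] a b _; exists (Posz ((a + b)%N %/ n.+2)%N).
have -> : nat_of_ord (a + b) = ((a + b)%N %% n.+2)%N by [].
have := divn_eq (a + b)%N n.+2; lia.
Qed.

Lemma Zp_natN n (a : 'Z_n) : (1 < n)%N ->
  {q : int | (nat_of_ord (- a))%:Z = - (nat_of_ord a)%:Z + n%:Z * q}.
Proof.
move=> n1; have [q] := Zp_natD a (- a) n1.
by rewrite subrr => eq; exists q; move: eq; rewrite /=; lia.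
Qed.

Lemma Zp_nat1 n : (1 < n)%N -> nat_of_ord (1 : 'Z_n) = 1%N.
Proof. by case: n => [|[|n]]. Qed.

Section Waves.
Variables (n s : nat).
Hypothesis n1 : (1 < n)%N.

Let n0 : (n%:Z != 0)%R. Proof. lia. Qed.

(** Records where a square wave is negative: for 0 < w < 1, truth means sin (pi (M x + p + w) / n) <
    0. *)
Definition wave (M p x : int) : bool := oddz ((M * x + p) %/ n)%Z.

Lemma wave_periodic M p q x : wave M p (x + 2 * (n%:Z * q)) = wave M p x.
Proof.
rewrite /wave.
have -> : M * (x + 2 * (n%:Z * q)) + p = (2 * (M * q)) * n%:Z + (M * x + p) by ring.
by rewrite divzMDl // oddzD oddzM2.
Qed.

Lemma wave_shift M p k x : wave M (p + 2 * M * k) x = wave M p (x + 2 * k).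
Proof. by rewrite /wave; congr (oddz (_ %/ _)%Z); ring. Qed.

Lemma wave_phaseD M p x q : wave M (p + n%:Z * q) x = oddz q (+) wave M p x.
Proof.
rewrite /wave.
have -> : M * x + (p + n%:Z * q) = q * n%:Z + (M * x + p) by ring.
by rewrite divzMDl // oddzD.
Qed.

Lemma wave_slopeD M p x q : wave (M + n%:Z * q) p x = oddz (q * x) (+) wave M p x.
Proof.
rewrite /wave.
have -> : (M + n%:Z * q) * x + p = (q * x) * n%:Z + (M * x + p) by ring.
by rewrite divzMDl // oddzD.
Qed.

Lemma wave_slopeN M p x : wave (- M) p x = ~~ wave M (- p - 1) x.
Proof.
rewrite /wave.
have -> : - M * x + p = - (M * x + (- p - 1)) - 1 by ring.
by rewrite oddz_divN //; lia.
Qed.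

(* The circle j carries the crossings at angles (2 i - o_j) pi / n, where
   o_j is 1 or 0; the sign array of a cylinder braid turns out to sample a
   square wave in these angles, up to one sign per circle. *)
Definition wave_array (C : nat -> bool) (M p : int) : sign_array s n :=
  [ffun c : 'Z_n * 'I_s.-1 =>
    C c.2 (+) wave M p (2 * (nat_of_ord c.1)%:Z - (odd c.2.+1)%:Z)].

Lemma rotate_wave_array (k : nat) C M p :
  rotate (k%:R) (wave_array C M p) = wave_array C M (p + 2 * M * k%:Z).
Proof.
apply/ffunP => c; rewrite !ffunE /=; congr (_ (+) _).
rewrite wave_shift.
have [q ->] := Zp_natD c.1 k%:R n1.
have [q' ->] : exists q' : int, (nat_of_ord (k%:R : 'Z_n))%:Z = k%:Z - n%:Z * q'.
  exists (Posz (k %/ n)%N); rewrite Zp_nat.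
  have -> : nat_of_ord (inZp k : 'Z_n) = (k %% n)%N.
    by case: n n1 => [|[|?]].
  have := divn_eq k n; lia.
rewrite -(wave_periodic _ _ (q + q')).
by congr wave; move: (Posz (nat_of_ord c.1)) (Posz (nat_of_bool _)) => i o; ring.
Qed.

(** Reflection sends x to - x modulo 2 n, and [wave M p (- x)] is the negation of
    [wave M (- p - 1) x]; the negation built into [mirror] cancels this one. *)
Lemma mirror0_wave_array C M p :
  mirror 0 (wave_array C M p) = wave_array C M (- p - 1).
Proof.
apply/ffunP => c; rewrite !ffunE -addbN; congr (_ (+) _).
suff [q ->] : exists q : int,
    2 * (nat_of_ord (if odd c.2.+1 then 0 + 1 - c.1 else 0 - c.1 : 'Z_n))%:Z -
      (odd c.2.+1)%:Z = - (2 * (nat_of_ord c.1)%:Z - (odd c.2.+1)%:Z) + 2 * (n%:Z * q).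
  rewrite wave_periodic /wave mulrN -mulNr.
  by rewrite -/(wave (- M) p _) wave_slopeN negbK.
have [qN eqN] := Zp_natN c.1 n1.
case: (odd _); rewrite add0r.
  have [qD eqD] := Zp_natD 1 (- c.1) n1.
  exists (qN - qD); move: eqD; rewrite Zp_nat1 // eqN => ->.
  by move: (Posz (nat_of_ord c.1)) => i; have -> : Posz true = 1 :> int by []; ring.
exists qN; rewrite eqN; move: (Posz (nat_of_ord c.1)) => i.
by have -> : Posz false = 0 :> int by []; ring.
Qed.

Lemma flip_wave_array C M p :
  flip (wave_array C M p) = wave_array (negb \o C) M p.
Proof. by apply/ffunP => c; rewrite !ffunE /= addNb. Qed.

Lemma wave_array_phaseD C M p q :
  wave_array C M (p + n%:Z * q) = wave_array (fun j => C j (+) oddz q) M p.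
Proof. by apply/ffunP => c; rewrite !ffunE wave_phaseD addbA. Qed.

(** The sampled x has the parity of j + 1, so the extra term q x is odd only for odd q on
    odd-numbered circles. *)
Lemma wave_array_slopeD C M p q :
  wave_array C (M + n%:Z * q) p =
  wave_array (fun j => C j (+) (oddz q && odd j.+1)) M p.
Proof.
apply/ffunP => c; rewrite !ffunE wave_slopeD addbA; congr (_ (+) _ (+) _).
rewrite /oddz; case: (odd _) => /=; lia.
Qed.

Lemma wave_array_slopeN C M p :
  wave_array C (- M) p = wave_array (negb \o C) M (- p - 1).
Proof. by apply/ffunP => c; rewrite !ffunE wave_slopeN /= addbN addNb. Qed.

End Waves.

Lemma eq_wave_array_in n s C C' M p :
  (forall j : nat, (j < s.-1)%N -> C j = C' j) ->
  wave_array n s C M p = wave_array n s C' M p.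
Proof. by move=> eqC; apply/ffunP => c; rewrite !ffunE eqC. Qed.

(** * The symmetries as an equivalence relation, and counting classes by representatives *)

Lemma rotateK n s (k : 'Z_n) : cancel (@rotate s n k) (rotate (- k)).
Proof. by move=> e; apply/ffunP => -[i j]; rewrite !ffunE /= subrK. Qed.

Lemma mirrorK n s (k : 'Z_n) : involutive (@mirror s n k).
Proof.
move=> e; apply/ffunP => -[i j]; rewrite !ffunE /= negbK.
by case: (odd j); rewrite /= subKr.
Qed.

Lemma flipK n s : involutive (@flip s n).
Proof. by move=> e; apply/ffunP => c; rewrite !ffunE negbK. Qed.

Lemma symmetry_step_sym n s : symmetric (@symmetry_step s n).
Proof.
suff imp e e' : symmetry_step e e' -> @symmetry_step s n e' e.
  by move=> e e'; apply/idP/idP; apply: imp.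
case/or3P => [/existsP[k /eqP->]|/existsP[k /eqP->]|/eqP->].
- by apply/or3P/Or31/existsP; exists (- k); rewrite rotateK.
- by apply/or3P/Or32/existsP; exists k; rewrite mirrorK.
- by apply/or3P/Or33; rewrite flipK.
Qed.

Lemma braid_equiv_sym n s : symmetric (@braid_equiv s n).
Proof. exact: sym_connect_sym (@symmetry_step_sym n s). Qed.

Lemma braid_equiv_trans n s : transitive (@braid_equiv s n).
Proof. exact: connect_trans. Qed.

Lemma braid_equiv_rotate n s k e : @braid_equiv s n e (rotate k e).
Proof. by apply/connect1/or3P/Or31/existsP; exists k. Qed.

Lemma braid_equiv_mirror n s k e : @braid_equiv s n e (mirror k e).
Proof. by apply/connect1/or3P/Or32/existsP; exists k. Qed.

Lemma braid_equiv_flip n s e : @braid_equiv s n e (flip e).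
Proof. by apply/connect1/or3P/Or33. Qed.

(** Every block is the set of y in [D] related to some [f u], so the partition lies in an image of
    [U]. The representatives [f u] may lie outside [D]. *)
Lemma card_equivalence_partition_le (T U : finType) (r : rel T) (D : {set T})
    (f : U -> T) :
  symmetric r -> transitive r ->
  {in D, forall x, exists u, r x (f u)} ->
  (#|equivalence_partition r D| <= #|U|)%N.
Proof.
move=> rC rT cover_f.
rewrite -cardsT; apply: leq_trans (leq_imset_card (fun u => [set y in D | r (f u) y]) _).
apply/subset_leq_card/fintype.subsetP => B /imsetP[x xD ->].
have [u xu] := cover_f x xD; apply/imsetP; exists u => //.
apply/setP => y; rewrite !inE; congr (_ && _).
by apply/idP/idP; apply: rT => //; rewrite rC.
Qed.

(** * Reduction to phase 0 and small slope *)

Section NormalForms.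
Variables (n s : nat).
Hypothesis n1 : (1 < n)%N.

Local Notation arr := (wave_array n s).

(** Both M x and n are multiples of the gcd, so adding a nonnegative r below it to M x never reaches
    the next multiple of n. *)
Lemma wave_small_phase M (r x : int) :
  0 <= r < gcdz M n -> wave n M r x = wave n M 0 x.
Proof.
move=> /andP[r0 rg].
have g0 : gcdz M n != 0 by lia.
have gM := divzK (dvdz_gcdl M n); have gn := divzK (dvdz_gcdr M n).
move: (gcdz M n) (M %/ gcdz M n)%Z (n %/ gcdz M n)%Z gM gn r0 rg g0.
move=> g M' n' gM gn r0 rg g0.
have red (t : int) : 0 <= t < g -> ((M * x + t) %/ n = (M' * x) %/ n')%Z.
  move=> tg; have -> : M * x + t = (M' * x) * g + t by rewrite -gM; ring.
  rewrite -gn [n' * g]mulrC divzMA_ge0 ?(ltW (le_lt_trans r0 rg)) //.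
  by rewrite divzMDl // [(t %/ g)%Z]divz_small ?addr0 // gez0_abs ?(ltW (le_lt_trans r0 rg)).
rewrite /wave !red //; lia.
Qed.

(** Rotations shift p by multiples of 2 M, and shifts by 2 n change nothing, so p matters only
    modulo 2 g, where g = gcd (M, n). A mirror image, if needed, makes the quotient of p by g even;
    what remains is a residue in [0, g), which the wave does not see. *)
Lemma braid_equiv_phase0 C M p : braid_equiv (arr C M p) (arr C M 0).
Proof.
wlog: p / ~~ oddz (p %/ gcdz M n)%Z.
  move=> ev; have [odd_p|] := boolP (oddz (p %/ gcdz M n)%Z); last exact: ev.
  apply: (braid_equiv_trans (y := arr C M (- p - 1))).
    by rewrite -mirror0_wave_array //; apply: braid_equiv_mirror.
  apply: ev; set g := gcdz M n.
  have g0 : (g > 0)%R by rewrite /g /gcdz; have := gcdn_gt0 `|M| `|n|; lia.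
  by rewrite oddz_divN // negbK.
set g := gcdz M n.
have g0 : (g > 0)%R by rewrite /g /gcdz; have := gcdn_gt0 `|M| `|n|; lia.
have := divz_eq p g; have := ltz_pmod p g0; have := modz_ge0 p (lt0r_neq0 g0).
set r := (p %% g)%Z => r0 rg.
have [u [v uv]] := Bezoutz M n; rewrite -/g in uv.
move=> pE ev; have [h hE] : exists h : int, (p %/ g)%Z = 2 * h.
  by exists ((p %/ g)%Z %/ 2)%Z; move: ev; rewrite /oddz; lia.
rewrite hE in pE.
(* With p = 2 h g + r and u M + v n = g, rotation by - h u leaves the phase r + 2 h v n. The residue
   of z modulo n serves because [rotate_wave_array] takes a natural number. *)
pose z := - h * u.
have zE := divz_eq z n.
have : (0 <= z %% n)%Z by apply: modz_ge0; lia.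
case: (z %% n)%Z zE => // k zE _.
apply: (braid_equiv_trans (braid_equiv_rotate k%:R _)).
rewrite rotate_wave_array //.
have -> : p + 2 * M * k = r + n%:Z * (2 * (h * v - M * (z %/ n)%Z)).
  have -> : Posz k = z - (z %/ n)%Z * n by rewrite {1}zE; ring.
  by rewrite pE -uv /z; ring.
rewrite wave_array_phaseD //.
suff -> : arr (fun j => C j (+) oddz (2 * (h * v - M * (z %/ n)%Z))) M r = arr C M 0.
  exact: connect0.
apply/ffunP => c; rewrite !ffunE oddzM2 addbF; congr (_ (+) _).
by apply: wave_small_phase; rewrite r0.
Qed.

Lemma braid_equiv_wave_array C M p : exists (C' : nat -> bool) (m : nat),
  [/\ C' 0%N = false, (m <= n./2)%N & braid_equiv (arr C M p) (arr C' m 0)].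
Proof.
suff [C' [m [mn eqv]]] : exists (C' : nat -> bool) (m : nat),
    (m <= n./2)%N /\ braid_equiv (arr C M p) (arr C' m 0).
  case C'0 : (C' 0%N); last by exists C', m.
  exists (negb \o C'), m; split=> //=; first by rewrite C'0.
  apply: braid_equiv_trans eqv _; rewrite -flip_wave_array.
  exact: braid_equiv_flip.
suff [C' [m [mn eqv]]] : exists (C' : nat -> bool) (m : int) ,
    (`|m| <= n./2)%N /\ braid_equiv (arr C M p) (arr C' m 0).
  exists (if 0 <= m then C' else negb \o C'), `|m|%N; split=> //.
  apply: braid_equiv_trans eqv _; case: ifP => m0.
    by rewrite gez0_abs //; apply: connect0.
  (* Negating the slope moves phase 0 to -1, so the phase has to be reduced once more. *)
  have -> : m = - (`|m|%N)%:Z by lia.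
  rewrite wave_array_slopeN // abszN.
  exact: braid_equiv_phase0.
(* m is the residue of M modulo n, or that residue minus n when it exceeds n / 2. *)
have [q [m [mn ->]]] : exists q m : int, (`|m| <= n./2)%N /\ M = m + n%:Z * q.
  have ME := divz_eq M n; have n0 : n%:Z != 0 by lia.
  have m0 := modz_ge0 M n0; have mn := ltz_mod M n0.
  have [mn2|mn2] := leqP `|(M %% n)%Z| n./2.
    by exists (M %/ n)%Z, (M %% n)%Z; split=> //; rewrite {1}ME; ring.
  exists ((M %/ n)%Z + 1), ((M %% n)%Z - n%:Z); split; last by rewrite {1}ME; ring.
  lia.
rewrite wave_array_slopeD //.
exists (fun j => C j (+) (oddz q && odd j.+1)), m; split=> //.
exact: braid_equiv_phase0.
Qed.

(** At an even argument h * (2 x) is a multiple of n, so lowering the phase to -1 crosses a jump; at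
    an odd one the value is h modulo n, and both h and h - 1 lie in [0, n). *)
Lemma wave_half h x : n = h.*2 ->
  wave n h (-1) (2 * x) = ~~ wave n h 0 (2 * x) /\
  wave n h (-1) (2 * x - 1) = wave n h 0 (2 * x - 1).
Proof.
move=> nE; have n0 : n%:Z != 0 by lia.
have h2 : 2 * h%:Z = n%:Z by lia.
rewrite /wave; split.
  have -> : h%:Z * (2 * x) + -1 = (x - 1) * n%:Z + (n%:Z - 1) by rewrite -h2; ring.
  have -> : h%:Z * (2 * x) + 0 = x * n%:Z + 0 by rewrite -h2; ring.
  by rewrite !divzMDl // !divz_small ?addr0 /oddz; lia.
have -> : h%:Z * (2 * x - 1) + -1 = (x - 1) * n%:Z + (h%:Z - 1) by rewrite -h2; ring.
have -> : h%:Z * (2 * x - 1) + 0 = (x - 1) * n%:Z + h%:Z by rewrite -h2; ring.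
by rewrite !divzMDl // !divz_small ?addr0 /oddz; lia.
Qed.

(** By [wave_half], the mirror image at phase 0 changes exactly the circles of odd index j, the
    even-numbered ones. Index 1 is among them and index 0 is not, so the second sign can be made
    [false] without disturbing the first. *)
Lemma braid_equiv_half_slope C h : n = h.*2 -> C 0%N = false ->
  exists C' : nat -> bool, [/\ C' 0%N = false, C' 1%N = false
    & braid_equiv (arr C h 0) (arr C' h 0)].
Proof.
move=> nE C0; case C1 : (C 1%N); last by exists C; split=> //; apply: connect0.
exists (fun j => C j (+) ~~ odd j.+1); split; rewrite ?C0 ?C1 //.
suff <- : mirror 0 (arr C h 0) = arr (fun j => C j (+) ~~ odd j.+1) h 0.
  exact: braid_equiv_mirror.
rewrite mirror0_wave_array // oppr0 sub0r; apply/ffunP => c; rewrite !ffunE.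
have [we wo] := wave_half (nat_of_ord c.1)%:Z nE.
rewrite -addbA; congr (_ (+) _); rewrite -[odd c.2.+1]/(~~ odd c.2).
by case: (odd c.2) => /=; rewrite ?subr0 // we.
Qed.

End NormalForms.

(** * Counting the normal forms *)

(** The first h signs are normalised to [false] and the next k are free. The value beyond them is a
    default that is never sampled when s - 1 <= h + k. *)
Definition pad_signs h k (c : {ffun 'I_k -> bool}) (j : nat) : bool :=
  (h <= j)%N && (if insub (j - h)%N is Some i then c i else false).

Lemma pad_signsE h k (C : nat -> bool) :
  (forall j, (j < h)%N -> C j = false) ->
  forall j, (j < h + k)%N -> C j = pad_signs h [ffun i : 'I_k => C (h + i)%N] j.
Proof.
move=> C0 j jhk; rewrite /pad_signs; have [hj|jh] /= := leqP h j; last exact: C0.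
by rewrite insubT => [|?]; rewrite ?ffunE /= ?subnKC //; lia.
Qed.

Lemma wave_array_pad n s h k (C : nat -> bool) M p :
  (forall j, (j < h)%N -> C j = false) -> (s.-1 <= h + k)%N ->
  wave_array n s (pad_signs h [ffun i : 'I_k => C (h + i)%N]) M p = wave_array n s C M p.
Proof.
move=> C0 shk; apply: eq_wave_array_in => j js.
by rewrite -pad_signsE // (leq_trans js).
Qed.

Section Counting.
Variables (n s : nat) (B : {set sign_array s n}).
Hypotheses (n1 : (1 < n)%N) (s1 : (1 < s)%N).
Hypothesis B_wave : {in B, forall e, exists C M p, e = wave_array n s C M p}.

Lemma card_wave_classes :
  (#|equivalence_partition (@braid_equiv s n) B| <= n./2.+1 * 2 ^ (s - 2))%N.
Proof.
pose f (x : 'I_n./2.+1 * {ffun 'I_(s - 2) -> bool}) :=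
  wave_array n s (pad_signs 1 x.2) (nat_of_ord x.1) 0.
apply: leq_trans (card_equivalence_partition_le (f := f) (@braid_equiv_sym n s)
  (@braid_equiv_trans n s) _) _; last by rewrite card_prod card_ffun !card_ord card_bool.
move=> e /B_wave[C [M [p ->]]].
have [C' [m [C'0 mn eqv]]] := braid_equiv_wave_array s n1 C M p.
exists (inord m, [ffun i => C' (1 + nat_of_ord i)%N]); rewrite /f /= inordK ?ltnS //.
by rewrite wave_array_pad //; [case | lia].
Qed.

Lemma card_wave_classes_even : ~~ odd n -> (2 < s)%N ->
  (#|equivalence_partition (@braid_equiv s n) B| <=
    n./2 * 2 ^ (s - 2) + 2 ^ (s - 3))%N.
Proof.
move=> n_even s2.
(* Slopes below n / 2 leave s - 2 free signs; slope n / 2 leaves s - 3. *)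
pose f (x : 'I_n./2 * {ffun 'I_(s - 2) -> bool} + {ffun 'I_(s - 3) -> bool}) :=
  match x with
  | inl y => wave_array n s (pad_signs 1 y.2) (nat_of_ord y.1) 0
  | inr c => wave_array n s (pad_signs 2 c) n./2 0
  end.
apply: leq_trans (card_equivalence_partition_le (f := f) (@braid_equiv_sym n s)
  (@braid_equiv_trans n s) _) _; last first.
  by rewrite card_sum card_prod !card_ffun !card_ord card_bool.
move=> e /B_wave[C [M [p ->]]].
have [C' [m [C'0 mn eqv]]] := braid_equiv_wave_array s n1 C M p.
move: mn; rewrite leq_eqVlt => /predU1P[mE|mn].
  have [|C2 [C20 C21 eqv2]] := braid_equiv_half_slope s n1 (h := n./2) _ C'0.
    by have := odd_double_half n; lia.
  exists (inr [ffun i => C2 (2 + nat_of_ord i)%N]) => /=.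
  rewrite wave_array_pad; [|by case=> [|[|]]|lia].
  by rewrite mE in eqv; apply: braid_equiv_trans eqv eqv2.
exists (inl (Ordinal mn, [ffun i => C' (1 + nat_of_ord i)%N])) => /=.
by rewrite wave_array_pad //; [case | lia].
Qed.

End Counting.

(** * Trigonometry and the sawtooth function *)

Section Trigonometry.
Context {R : realType}.
Implicit Types (x y : R) (k : int).

Lemma sinDzpi x k : sin (x + pi * k%:~R) = (-1) ^+ oddz k * sin x.
Proof.
have nat_case y (m : nat) : sin (y + pi * m%:R) = (-1) ^+ odd m * sin y.
  by rewrite mulr_natr (alternatingn (@sinDpi R)) signr_odd.
case: k => m; first by rewrite nat_case oddz_nat.
rewrite NegzE oddzN oddz_nat.
rewrite -[in RHS](subrK (pi * m.+1%:R) x) nat_case mulrA -signr_addb addbb mul1r.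
by congr sin; rewrite mulrNz mulrN.
Qed.

Lemma cosDz2pi x k : cos (x + 2 * pi * k%:~R) = cos x.
Proof.
have nat_case y (m : nat) : cos (y + 2 * pi * m%:R) = cos y.
  by rewrite mulr_natr mulr_natl (periodicn (@cosD2pi R)).
case: k => m; first exact: nat_case.
rewrite NegzE -[in RHS](subrK (2 * pi * m.+1%:R) x) nat_case.
by congr cos; rewrite mulrNz mulrN.
Qed.

Lemma sinDz2pi x k : sin (x + 2 * pi * k%:~R) = sin x.
Proof.
have -> : 2 * pi * k%:~R = pi * (2 * k)%:~R :> R by rewrite intrM; ring.
by rewrite sinDzpi oddzM2 mul1r.
Qed.

Lemma sin_pi_floor x : sin (pi * x) =
  (-1) ^+ oddz (Num.floor x) * sin (pi * (x - (Num.floor x)%:~R)).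
Proof. by rewrite -sinDzpi; congr sin; ring. Qed.

Lemma sin_pi_frac_gt0 x : x != (Num.floor x)%:~R ->
  0 < sin (pi * (x - (Num.floor x)%:~R)).
Proof.
move=> xz; have /andP[x0 x1] := floor_itv x.
have p0 := pi_gt0 R; apply: sin_gt0_pi; apply/andP; split.
  by rewrite mulr_gt0 // subr_gt0 lt_neqAle eq_sym xz.
by rewrite -[ltRHS]mulr1 ltr_pM2l // ltrBlDl -(intrD _ _ 1).
Qed.

Lemma sin_pi_eq0 x : sin (pi * x) = 0 -> x = (Num.floor x)%:~R.
Proof.
move=> sx0; apply/eqP/contraT => /sin_pi_frac_gt0.
by move/eqP: sx0; rewrite sin_pi_floor mulf_eq0 signr_eq0 /= => /eqP->; rewrite ltxx.
Qed.

Lemma sin_pi_lt0 x : sin (pi * x) != 0 -> (sin (pi * x) < 0) = oddz (Num.floor x).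
Proof.
rewrite sin_pi_floor mulf_eq0 signr_eq0 /= => sx.
have /sin_pi_frac_gt0 : x != (Num.floor x)%:~R.
  by apply: contra_neq sx => {1}->; rewrite subrr mulr0 sin0.
by case: (oddz _) => s0; rewrite ?mulN1r ?oppr_lt0 // mul1r; apply: lt_gtF.
Qed.

Lemma cosB_sin x y : cos x - cos y = - 2 * (sin ((x + y) / 2) * sin ((x - y) / 2)).
Proof.
have {1}-> : x = (x + y) / 2 + (x - y) / 2 by field.
have {3}-> : y = (x + y) / 2 - (x - y) / 2 by field.
by rewrite cosD cosB; ring.
Qed.

(** With g the sawtooth, cos (2 pi z) = - cos (pi g(z)); as pi g(z) lies in [0, pi], where cos
    decreases, the two orders agree. *)
Lemma sawtooth_lt x y :
  (sawtooth x < sawtooth y) = (cos (2 * pi * x) < cos (2 * pi * y)).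
Proof.
have p0 := pi_gt0 R.
have cosE (z : R) : cos (2 * pi * z) = - cos (pi * sawtooth z).
  rewrite -[in LHS](subrK (Num.floor z)%:~R z) mulrDr cosDz2pi -cosDpi.
  have -> : pi * sawtooth z = `|2 * pi * (z - (Num.floor z)%:~R - 2^-1)|.
    by rewrite /sawtooth mulrCA mulrA normrM gtr0_norm // mulr_gt0.
  have -> : 2 * pi * (z - (Num.floor z)%:~R) =
      2 * pi * (z - (Num.floor z)%:~R - 2^-1) + pi by field.
  by rewrite !cosDpi cos_norm.
have saw01 (z : R) : 0 <= sawtooth z <= 1.
  rewrite /sawtooth mulr_ge0 //=; have /andP[x0 x1] := floor_itv z.
  rewrite intrD in x1.
  suff : `|z - (Num.floor z)%:~R - 2^-1| <= 2^-1 by lra.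
  by rewrite ler_norml; lra.
have sawpi (z : R) : pi * sawtooth z \in `[0, pi].
  have /andP[z0 z1] := saw01 z.
  rewrite in_itv /=; apply/andP; split; first by rewrite mulr_ge0 // ltW.
  by rewrite -[leRHS]mulr1 ler_pM2l.
by rewrite !cosE ltrN2 ltr_cos ?sawpi // (ltr_pM2l p0).
Qed.

Lemma cisD x y : cis (x + y) = cis x * cis y.
Proof.
rewrite /cis cosD sinD; apply/eqP.
by rewrite eq_complex /= eqxx addrC /= mulrC eqxx.
Qed.

Lemma modulus_cis x : modulus (cis x) = 1.
Proof. by rewrite /modulus /= cos2Dsin2 sqrtr1. Qed.

Lemma cis_inj x y : cis x = cis y -> exists k, x = y + 2 * pi * k%:~R.
Proof.
move=> [cxy sxy]; have : cos (x - y) = 1.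
  by rewrite cosB cxy sxy -!expr2 cos2Dsin2.
have -> : x - y = ((x - y) / 2) *+ 2 by field.
rewrite cos_mulr2n => c1; have : sin ((x - y) / 2) = 0.
  by apply/eqP; rewrite -sqrf_eq0 sin2cos2; apply/eqP; lra.
have p0 : pi != 0 :> R by rewrite gt_eqF ?pi_gt0.
have halfE (p z : R) : p != 0 -> z / 2 = p * (z / (2 * p)) by move=> ?; field.
rewrite (halfE _ _ p0) => /sin_pi_eq0 xy; exists (Num.floor ((x - y) / (2 * pi))).
by rewrite -xy mulrC divfK ?mulf_neq0 // addrC subrK.
Qed.

Lemma cisDz2pi x k : cis (x + 2 * pi * k%:~R) = cis x.
Proof. by rewrite /cis cosDz2pi sinDz2pi. Qed.

End Trigonometry.

(** * Crossings of the projected curve *)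

Lemma coprime_mul_inj (s n : nat) (a b : int) : coprime s n ->
  0 <= a < n%:Z -> 0 <= b < n%:Z -> (n %| s%:Z * (a - b))%Z -> a = b.
Proof.
move=> sn an bn; rewrite Gauss_dvdzr; last by rewrite coprimezE /= coprime_sym.
move=> nab; have := modz_small an; have := modz_small bn.
by move: nab; rewrite -eqz_mod_dvd => /eqP -> -> ->.
Qed.

Lemma coprime_bezout (s n : nat) : coprime s n ->
  exists r q : int, r * s%:Z + q * n%:Z = 1.
Proof.
move=> sn; have [r [q rq]] := Bezoutz s n; exists r, q.
by rewrite rq /gcdz /= (eqP sn).
Qed.

Lemma sqr_lt_near (F : realDomainType) (x y : F) : - y < x -> x < y -> x ^+ 2 < y ^+ 2.
Proof. by nra. Qed.

Lemma sqr_lt_neg (F : realDomainType) (x y : F) : y <= 0 -> x < y -> y ^+ 2 <= x ^+ 2.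
Proof. by nra. Qed.

Section Crossings.
Local Open Scope classical_set_scope.
Local Open Scope ring_scope.
Context {R : realType} (s n : nat).
Hypotheses (s0 : (0 < s)%N) (hn2s : (2 * s + 1 <= n)%N) (hsn : coprime s n).
Implicit Types (k a b D : int) (t u tau : R).

Let p0 : 0 < pi :> R. Proof. exact: pi_gt0. Qed.
Let n_gt0 : 0 < n%:R :> R. Proof. by rewrite ltr0n; lia. Qed.
Let n_neq0 : n%:R != 0 :> R. Proof. exact: lt0r_neq0. Qed.
Let nz0 : n%:Z != 0. Proof. lia. Qed.
Let s_itv : - s%:Z <= s%:Z <= s%:Z. Proof. lia. Qed.

(** Vertices, edge midpoints and crossings all lie at angles of this form; [ray s] is half the
    central angle of an edge. *)
Definition ray D : R := pi * D%:~R / n%:R.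

Lemma rayN D : ray (- D) = - ray D.
Proof. by rewrite /ray mulrNz mulrN mulNr. Qed.

Lemma ray_lt D D' : (ray D < ray D') = (D < D').
Proof. by rewrite /ray -!mulrA ltr_pM2l // ltr_pM2r ?invr_gt0 // ltr_int. Qed.

(** Follows from 2 s < n; it makes the cosines below positive and tan strictly increasing on the
    angles in use. *)
Lemma ray_halfpi D : - s%:Z <= D <= s%:Z -> - (pi / 2) < ray D < pi / 2.
Proof.
move=> Ds.
have ub (D' : int) : D' <= s -> ray D' < pi / 2.
  move=> D's; rewrite /ray -mulrA ltr_pM2l // ltr_pdivrMr // ltr_pdivlMl //.
  by rewrite -(intrM _ 2) -[n%:R]/(n%:Z%:~R) ltr_int; lia.
have /andP[Dl Du] := Ds; rewrite (ub _ Du) andbT ltrNl -rayN.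
by apply: ub; rewrite lerNl.
Qed.

Lemma ray_itv D : - s%:Z <= D <= s%:Z -> ray D \in `](- (pi / 2)), (pi / 2)[.
Proof. by move=> /ray_halfpi; rewrite in_itv. Qed.

Lemma cos_ray_gt0 D : - s%:Z <= D <= s%:Z -> 0 < cos (ray D).
Proof. by move=> /ray_halfpi; apply: cos_gt0_pihalf. Qed.

Let cos_s : 0 < cos (ray s). Proof. by apply: cos_ray_gt0; lia. Qed.

Let sin_s : 0 < sin (ray s).
Proof.
have /andP[_ ub] : - (pi / 2) < ray s < pi / 2 by apply: ray_halfpi; lia.
apply: sin_gt0_pihalf; rewrite ub andbT.
by rewrite /ray divr_gt0 // mulr_gt0 // ltr0z.
Qed.

Let tan_s : 0 < tan (ray s). Proof. by rewrite /tan divr_gt0. Qed.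

(* The point of edge k with barycentric coordinate (1 + tau) / 2. *)
Definition edge_pt k tau : R[i] :=
  cis (ray (s%:Z * (2 * k + 1))) * (cos (ray s) +i* (tau * sin (ray s)))%C.

(** Along edge k, tau runs over [-1, 1) with 0 at the midpoint, so that the distance from the center
    depends on tau^2 alone. *)
Definition edge_time k tau : R := (k%:~R + (tau + 1) / 2) / n%:R.

(** Vertices k and k + 1 lie at angle [ray s] on either side of the midpoint direction; once that
    direction is rotated to the real axis, the edge is the vertical chord at abscissa cos (ray
    s). *)
Lemma proj_curve_floor t :
  proj_curve s n t =
  edge_pt (Num.floor (n%:R * t)) (2 * (n%:R * t - (Num.floor (n%:R * t))%:~R) - 1).
Proof.
rewrite /proj_curve /edge_pt; set k := Num.floor _; set w := n%:R * t - k%:~R.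
have vE j : vertex s n j = cis (ray (s%:Z * (2 * j))).
  rewrite /vertex /ray !intrM; congr cis.
  by rewrite -[s%:Z%:~R]/(s%:R : R); move: (pi : R) => p; field.
rewrite !vE.
have -> : ray (s%:Z * (2 * k)) = ray (s%:Z * (2 * k + 1)) + - ray s.
  by rewrite /ray !intrM !intrD !intrM; move: (pi : R) => p; field.
have -> : ray (s%:Z * (2 * (k + 1))) = ray (s%:Z * (2 * k + 1)) + ray s.
  by rewrite /ray !intrM !intrD !intrM; move: (pi : R) => p; field.
rewrite !cisD /cis cosN sinN.
move: (cos _) (sin _) (cos _) (sin _) => c1 s1 c2 s2.
apply/eqP; rewrite eq_complex /=; apply/andP; split; apply/eqP; ring.
Qed.

Lemma floor_edge_time k tau : -1 <= tau < 1 -> Num.floor (n%:R * edge_time k tau) = k.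
Proof.
move=> tau1; apply: floor_def; rewrite /edge_time [n%:R * _]mulrC divfK // intrD.
by move: (k%:~R : R) => x; lra.
Qed.

Lemma proj_edge_time k tau : -1 <= tau < 1 -> proj_curve s n (edge_time k tau) = edge_pt k tau.
Proof.
move=> tau1; rewrite proj_curve_floor floor_edge_time // /edge_time.
by congr edge_pt; rewrite [n%:R * _]mulrC divfK //; field.
Qed.

Lemma edge_time_itv k tau : -1 <= tau < 1 -> (edge_time k tau \in `[0, 1[) = (0 <= k < n%:Z).
Proof.
move=> tau1; rewrite in_itv /=; have := floor_edge_time k tau1.
set t := edge_time k tau => kE.
rewrite -[in RHS]kE floor_ge0 floor_lt_int -[n%:Z%:~R]/(n%:R : R).
rewrite (pmulr_rge0 t n_gt0); congr andb.
by rewrite -{2}[n%:R]mulr1 ltr_pM2l.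
Qed.

Lemma edge_timeP t : t \in `[0, 1[ ->
  exists k tau, [/\ 0 <= k < n%:Z, -1 <= tau < 1 & t = edge_time k tau].
Proof.
move=> t01; set k := Num.floor (n%:R * t); pose tau := 2 * (n%:R * t - k%:~R) - 1.
have tau1 : -1 <= tau < 1.
  have := floor_itv (n%:R * t); rewrite -/k intrD /tau.
  by move: (n%:R * t) (k%:~R : R) => x y; lra.
have tE : t = edge_time k tau by rewrite /edge_time /tau; field.
by exists k, tau; rewrite -(edge_time_itv _ tau1) -tE.
Qed.

Lemma modulus_edge_pt k tau :
  modulus (edge_pt k tau) = Num.sqrt (cos (ray s) ^+ 2 + (tau * sin (ray s)) ^+ 2).
Proof.
rewrite /modulus /edge_pt ComplexField.Normc.normcM.
by rewrite -/(modulus (cis _)) modulus_cis mul1r.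
Qed.

Lemma modulus_edge_pt_lt k tau k' tau' :
  (modulus (edge_pt k tau) < modulus (edge_pt k' tau')) = (tau ^+ 2 < tau' ^+ 2).
Proof.
rewrite !modulus_edge_pt ltr_sqrt; last first.
  by rewrite ltr_pwDl ?sqr_ge0 // exprn_gt0.
by rewrite ltrD2l !exprMn ltr_pM2r // exprn_gt0.
Qed.

(* Edges a and b with s (b - a) = D modulo n meet at the points with
   tau = lam D on a and tau = - lam D on b. *)
Definition lam D : R := tan (ray D) / tan (ray s).

(** The line of an edge has distance cos (ray s) from the center, so this is the modulus of its
    point seen at angle [ray D] from the midpoint direction. *)
Definition radius D : R := cos (ray s) / cos (ray D).

Lemma lamN D : lam (- D) = - lam D.
Proof. by rewrite /lam rayN tanN mulNr. Qed.

Lemma lam_lt D D' : - s%:Z <= D <= s%:Z -> - s%:Z <= D' <= s%:Z ->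
  (lam D < lam D') = (D < D').
Proof.
by move=> Ds D's; rewrite /lam ltr_pM2r ?invr_gt0 // ltr_tan ?ray_itv // ray_lt.
Qed.

Lemma lam0 : lam 0 = 0.
Proof. by rewrite /lam /ray mulr0 mul0r tan0 mul0r. Qed.

Lemma lam1 : lam s = 1.
Proof. by rewrite /lam divff // lt0r_neq0. Qed.

Lemma lam_itv D : `|D| < s%:Z -> -1 < lam D < 1.
Proof. by move=> Ds; rewrite -lam1 -lamN !lam_lt; lia. Qed.

Lemma radiusN D : radius (- D) = radius D.
Proof. by rewrite /radius rayN cosN. Qed.

Lemma radius_gt0 D : `|D| < s%:Z -> 0 < radius D.
Proof. by move=> Ds; rewrite /radius divr_gt0 // cos_ray_gt0; lia. Qed.

Lemma radius_abs D : radius `|D| = radius D.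
Proof. by case: (ger0P D) => D0; rewrite ?radiusN. Qed.

Lemma radius_lt D D' : 0 <= D < s%:Z -> 0 <= D' < s%:Z ->
  (radius D < radius D') = (D < D').
Proof.
move=> Ds D's.
have itv (D1 : int) : 0 <= D1 < s%:Z -> ray D1 \in `[0, pi].
  move=> Ds1; have /andP[_ ub] : - (pi / 2) < ray D1 < pi / 2 by apply: ray_halfpi; lia.
  rewrite in_itv /=; apply/andP; split; last by move: p0 ub; lra.
  by have /andP[D10 _] := Ds1; rewrite /ray !mulr_ge0 ?invr_ge0 ?ler0z // ltW.
by rewrite /radius ltr_pM2l // ltf_pV2 ?posrE ?cos_ray_gt0 ?ltr_cos ?itv ?ray_lt; lia.
Qed.

(** Since tau sin (ray s) = cos (ray s) tan x, the point of the chord is cos (ray s) / cos x times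
    [cis x], up to the rotation of the edge. *)
Lemma edge_pt_polar k x tau : 0 < cos x -> tau = tan x / tan (ray s) ->
  edge_pt k tau = (cos (ray s) / cos x)%:C%C * cis (ray (s%:Z * (2 * k + 1)) + x).
Proof.
move=> cx ->; rewrite /edge_pt cisD mulrCA; congr (_ * _).
have cx0 := lt0r_neq0 cx; have cs0 := lt0r_neq0 cos_s; have ss0 := lt0r_neq0 sin_s.
rewrite /cis /tan; apply/eqP; rewrite eq_complex /=.
by apply/andP; split; apply/eqP; field; rewrite ?cx0 ?cs0 ?ss0.
Qed.

Lemma edge_pt_lam k D : `|D| < s%:Z ->
  edge_pt k (lam D) = (radius D)%:C%C * cis (ray (s%:Z * (2 * k + 1) + D)).
Proof.
move=> Ds; rewrite (@edge_pt_polar k (ray D)) ?cos_ray_gt0 //; last lia.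
by congr (_ * cis _); rewrite /ray intrD; move: (pi : R) => p; field.
Qed.

Lemma modulus_edge_pt_lam k D : `|D| < s%:Z -> modulus (edge_pt k (lam D)) = radius D.
Proof.
move=> Ds; rewrite edge_pt_lam // /modulus ComplexField.Normc.normcM.
rewrite -/(modulus (cis _)) modulus_cis mulr1 /= expr0n /= addr0.
by rewrite sqrtr_sqr gtr0_norm // radius_gt0.
Qed.

Lemma cis_ray_eq D D' : cis (ray D) = cis (ray D') <-> exists k, D = D' + 2 * (n%:Z * k).
Proof.
split=> [/cis_inj [k eqr]|[k ->]]; last first.
  rewrite -[RHS](cisDz2pi _ k) /ray intrD !intrM; congr cis.
  by rewrite -[n%:Z%:~R]/(n%:R : R); move: (pi : R) => p; field.
exists k; apply: (@intr_inj R); apply: (mulfI (lt0r_neq0 p0)).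
apply: (mulIf (invr_neq0 n_neq0)).
rewrite -/(ray D) eqr /ray intrD !intrM.
by rewrite -[n%:Z%:~R]/(n%:R : R); move: (pi : R) => p; field.
Qed.

Lemma radius_inj_cis x y (r : R) : 0 < r -> r%:C%C * cis x = r%:C%C * cis y -> cis x = cis y.
Proof.
move=> r0; apply: mulfI; rewrite eq_complex /= eqxx andbT.
exact: lt0r_neq0.
Qed.

Lemma edge_time_inj k k' tau tau' : -1 <= tau < 1 -> -1 <= tau' < 1 ->
  edge_time k tau = edge_time k' tau' -> k = k' /\ tau = tau'.
Proof.
move=> tau1 tau'1 eqt; have kk' : k = k'.
  by rewrite -(floor_edge_time k tau1) eqt floor_edge_time.
split=> //; move: eqt; rewrite /edge_time kk' => /(mulIf (invr_neq0 n_neq0)).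
by move=> /addrI; lra.
Qed.

Lemma lam_itvW D : `|D| < s%:Z -> -1 <= lam D < 1.
Proof. by move=> /lam_itv/andP[/ltW-> ->]. Qed.

Lemma lam_inj D D' : `|D| < s%:Z -> `|D'| < s%:Z -> lam D = lam D' -> D = D'.
Proof.
move=> Ds D's eql; have := lam_lt (D := D) (D' := D'); have := lam_lt (D := D') (D' := D).
by rewrite eql ltxx; lia.
Qed.

(** * Double points of the projected curve *)

Definition edges_meet a b D : Prop :=
  [/\ 0 <= a < n%:Z, 0 <= b < n%:Z & (n %| s%:Z * (b - a) - D)%Z].

(** Both points have modulus [radius D], and their angles s (2 a + 1) + D and s (2 b + 1) - D, in
    units of pi / n, differ by 2 (D - s (b - a)), a multiple of 2 n. *)
Lemma double_pt_lam a b D : D != 0 -> `|D| < s%:Z -> edges_meet a b D ->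
  double_pt s n (edge_time a (lam D)) (edge_time b (lam (- D))).
Proof.
move=> D0 Ds [an bn /dvdzP[q qE]].
have NDs : `|- D| < s%:Z by rewrite normrN.
split; rewrite ?edge_time_itv ?lam_itvW //.
  apply/eqP => /edge_time_inj[]; rewrite ?lam_itvW // => _ /(lam_inj Ds NDs).
  by move: D0; lia.
rewrite !proj_edge_time ?lam_itvW // !edge_pt_lam // radiusN; congr (_ * _).
apply/cis_ray_eq; exists (- q).
have -> : n%:Z * - q = - (q * n%:Z) by ring.
by rewrite -qE; ring.
Qed.

(** Equal moduli force tau' = tau or tau' = - tau. The first case makes the edges equal, hence t =
    u. In the second, comparing polar angles shows that the offset x is [ray D] for an integer D
    congruent to s (b - a). *)
Lemma double_ptP t u : double_pt s n t u -> exists a b D,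
  [/\ D != 0, `|D| < s%:Z & edges_meet a b D] /\
  (t = edge_time a (lam D) /\ u = edge_time b (lam (- D))).
Proof.
move=> [/edge_timeP[a [tau [an tau1 tE]]] /edge_timeP[b [tau' [bn tau'1 uE]]]].
rewrite tE uE => tu; rewrite !proj_edge_time // => eqpt.
have : tau ^+ 2 == tau' ^+ 2.
  rewrite eq_le !leNgt -(modulus_edge_pt_lt b tau' a) -(modulus_edge_pt_lt a tau b).
  by rewrite eqpt ltxx.
have cs0 := lt0r_neq0 cos_s; have ts0 := lt0r_neq0 tan_s.
pose x := atan (tau * tan (ray s)).
have xtau : tau = tan x / tan (ray s) by rewrite atanK mulfK.
have x2 : - (pi / 2) < x < pi / 2 by rewrite atan_gtNpi2 atan_ltpi2.
have cx : 0 < cos x by apply: cos_gt0_pihalf.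
have r0 : 0 < cos (ray s) / cos x by rewrite divr_gt0.
rewrite (edge_pt_polar _ cx xtau) in eqpt.
rewrite eqf_sqr; have [tautau' _|ntau /= /eqP tauN] := eqVneq tau tau'.
  rewrite -tautau' (edge_pt_polar _ cx xtau) in eqpt.
  have /cis_inj[k] := radius_inj_cis r0 eqpt.
  rewrite addrAC => /addIr eqr.
  have /cis_ray_eq[k'] : cis (ray (s%:Z * (2 * a + 1))) = cis (ray (s%:Z * (2 * b + 1))).
    by rewrite eqr cisDz2pi.
  move=> eqk; case/eqP: tu; rewrite tautau'; congr edge_time.
  apply: (coprime_mul_inj hsn an bn); apply/dvdzP; exists k'.
  apply: (@mulfI int 2) => //; move: eqk; move: (s%:Z) (n%:Z) => s' n' eqk.
  have -> : 2 * (s' * (a - b)) = s' * (2 * a + 1) - s' * (2 * b + 1) by ring.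
  by rewrite eqk; ring.
have tau'E : tau' = tan (- x) / tan (ray s) by rewrite tanN mulNr -xtau tauN opprK.
have cNx : 0 < cos (- x) by rewrite cosN.
rewrite (edge_pt_polar _ cNx tau'E) cosN in eqpt.
have /cis_inj[k eqr] := radius_inj_cis r0 eqpt.
pose D := s%:Z * (b - a) + n%:Z * k.
have xD : x = ray D.
  have -> : x = (ray (s%:Z * (2 * b + 1)) - ray (s%:Z * (2 * a + 1)) + 2 * pi * k%:~R) / 2.
    by move: eqr; set y := ray _; set z := ray _; set w := 2 * pi * _; lra.
  rewrite /ray /D !(intrD, intrM, mulrNz) -[n%:Z%:~R]/(n%:R : R).
  by move: (pi : R) => p; field.
have tauD : tau = lam D by rewrite xtau xD.
have tauND : tau' = lam (- D) by rewrite lamN -tauD tauN opprK.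
(* D < s comes from tau < 1; the strict bound - D < s comes from tau' = - tau < 1, as -1 <= tau is
   not strict. *)
have Ds : `|D| < s%:Z.
  have ub y D' : y < 1 -> ray D' = atan (y * tan (ray s)) -> D' < s.
    move=> y1 rD; rewrite -(@ray_lt D') rD -[ltRHS]tanK; last first.
      exact: ray_itv.
    by apply: lt_atan; rewrite -[ltRHS]mul1r (ltr_pM2r tan_s).
  have /andP[_ t1] := tau1; have /andP[_ t1'] := tau'1.
  rewrite ltr_norml (ub tau) // ?andbT -?xD //.
  by rewrite ltrNl (ub tau') // rayN -xD /x -atanN -mulNr tauN opprK.
exists a, b, D; rewrite tauD tauND; split=> //; split=> //.
  by apply: contra_neq ntau => D0; rewrite tauD tauND D0 oppr0.
by split=> //; apply/dvdzP; exists (- k); rewrite /D; ring.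
Qed.
Lemma edges_meet_ex a D : 0 <= a < n%:Z -> exists b, edges_meet a b D.
Proof.
move=> an; have [r [q rq]] := coprime_bezout hsn; have n_gt0z : 0 < n%:Z by rewrite ltz_nat -(ltr0n R).
(* r inverts s modulo n, so this b solves s (b - a) = D modulo n. *)
exists ((a + r * D) %% n)%Z; split=> //.
  by rewrite modz_ge0 ?ltz_pmod.
have bE := divz_eq (a + r * D) n.
apply/dvdzP; exists (- (q * D) - s%:Z * ((a + r * D) %/ n)%Z).
have -> : ((a + r * D) %% n)%Z = a + r * D - ((a + r * D) %/ n)%Z * n%:Z.
  by rewrite {2}bE; ring.
move: ((a + _) %/ n)%Z => x.
have -> : s%:Z * (a + r * D - x * n%:Z - a) - D =
    (- (q * D) - s%:Z * x) * n%:Z + D * (r * s%:Z + q * n%:Z - 1) by ring.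
by rewrite rq subrr mulr0 addr0.
Qed.

(** * Circles of crossings, their angles and the left string *)

Lemma crossing_radiiE :
  @crossing_radii R s n = [set r | exists2 D : int, 0 < D < s%:Z & r = radius D]%classic.
Proof.
apply/seteqP; split=> r /=.
  move=> [P [t [u [/double_ptP[a [b [D [[D0 Ds _] [-> _]]]]] <-]]] <-].
  exists `|D|; first by rewrite normr_gt0 D0.
  by rewrite proj_edge_time ?lam_itvW // modulus_edge_pt_lam // radius_abs.
move=> [D /andP[D0 Ds] ->].
have Ds' : `|D| < s%:Z by rewrite gtr0_norm.
have [b mt] : exists b, edges_meet 0 b D.
  by apply: edges_meet_ex; rewrite lexx ltz_nat -(ltr0n R).
have dt := double_pt_lam (lt0r_neq0 D0) Ds' mt.
exists (proj_curve s n (edge_time 0 (lam D))).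
  by exists (edge_time 0 (lam D)), (edge_time b (lam (- D))).
by rewrite proj_edge_time ?lam_itvW // modulus_edge_pt_lam.
Qed.

(** [radius] increases on [0, s), so the circles outside that of E belong to E + 1, ..., s - 1, and
    there are s - 1 - E of them. *)
Lemma card_larger_radii (E : int) (j : nat) : 0 < E < s%:Z ->
  ([set r | @crossing_radii R s n r /\ radius E < r]%classic #= `I_j)%card <->
  E = s%:Z - j.+1%:Z.
Proof.
move=> Es.
have [N NE] : exists N : nat, N%:Z = s%:Z - 1 - E.
  by exists (absz (s%:Z - 1 - E)%R); rewrite gez0_abs //; move: Es; clear; lia.
have idx (k : nat) : (k < N)%N -> 0 <= E + 1 + k%:Z < s%:Z by move: Es NE; clear; lia.
have -> : [set r | @crossing_radii R s n r /\ radius E < r]%classic =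
    ((fun k : nat => radius (E + 1 + k%:Z)) @` `I_N)%classic.
  rewrite crossing_radiiE; apply/seteqP; split=> r /=.
    move=> [[D Ds ->]]; rewrite radius_lt; [|by move: Es; clear; lia|by move: Ds; clear; lia].
    move=> ED; exists (absz (D - E - 1)%R); first by move: NE Ds ED; clear; lia.
    by congr radius; move: ED; clear; lia.
  move=> [k kN <-]; have kE := idx k kN; split.
    by exists (E + 1 + k%:Z) => //; move: kE Es; clear; lia.
  by rewrite radius_lt //; move: Es; clear; lia.
have inj : {in `I_N%classic &, injective (fun k : nat => radius (E + 1 + k%:Z))}.
  move=> k k'; rewrite !inE => kN k'N eqr.
  have := radius_lt (idx _ kN) (idx _ k'N); have := radius_lt (idx _ k'N) (idx _ kN).
  by rewrite eqr ltxx; clear; lia.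
rewrite (card_eql (inj_card_eq inj)).
split=> [/card_eq_II|] NJ; first by move: NE; rewrite NJ; clear; lia.
by apply/card_eq_II; move: NE; rewrite NJ; clear; lia.
Qed.

Lemma edge_time_lt k tau tau' : (edge_time k tau < edge_time k tau') = (tau < tau').
Proof.
rewrite /edge_time ltr_pM2r ?invr_gt0 // ltrD2l ltr_pM2r ?invr_gt0 //.
by rewrite ltrD2r.
Qed.

Lemma edge_time_onto k t : t = edge_time k (2 * (n%:R * t - k%:~R) - 1).
Proof. by rewrite /edge_time; field. Qed.

(** The modulus grows with tau^2, so the curve arrives from nearer the center exactly when it has
    passed the midpoint of the edge. *)
Lemma left_nearer k tau : -1 < tau < 1 ->
  (\forall v \near (edge_time k tau)^'-,
     modulus (proj_curve s n v) < modulus (proj_curve s n (edge_time k tau))) <->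
  0 < tau.
Proof.
move=> /andP[tau_gt tau_lt]; set t := edge_time k tau.
have tau1 : -1 <= tau < 1 by rewrite ltW.
have nearerE v tau' : v = edge_time k tau' -> -1 <= tau' < 1 ->
    (modulus (proj_curve s n v) < modulus (proj_curve s n t)) = (tau' ^+ 2 < tau ^+ 2).
  by move=> -> tau'1; rewrite !proj_edge_time // modulus_edge_pt_lt.
split=> [nearer|tau0].
  rewrite ltNge; apply/negP => tau0.
  near t^'- => v.
  have vt : v < t by near: v; exact: nbhs_left_lt.
  have v1 : edge_time k (-1) < v.
    by near: v; apply: nbhs_left_gt; rewrite edge_time_lt.
  have : modulus (proj_curve s n v) < modulus (proj_curve s n t) by near: v.
  have vE := edge_time_onto k v; move: vE vt v1; set tau' := _ - 1 => vE.
  rewrite vE !edge_time_lt -vE => vt v1.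
  rewrite (nearerE _ _ vE); last by rewrite ltW //= (lt_trans vt).
  by rewrite ltNge (sqr_lt_neg tau0 vt).
near=> v.
have vt : v < t by near: v; exact: nbhs_left_lt.
have v1 : edge_time k (- tau) < v.
  by near: v; apply: nbhs_left_gt; rewrite edge_time_lt; lra.
have vE := edge_time_onto k v; move: vE vt v1; set tau' := _ - 1 => vE.
rewrite vE !edge_time_lt -vE => vt v1.
rewrite (nearerE _ _ vE); last by lra.
exact: sqr_lt_near.
Unshelve. all: by end_near. Qed.

Lemma crossing_angleE (i : 'Z_n) (j : nat) :
  crossing_angle i j = ray (2 * (nat_of_ord i)%:Z - (odd j.+1)%:Z).
Proof.
rewrite /crossing_angle /ray [_ * pi]mulrC; congr (_ * _ / _).
by rewrite intrD intrM mulrNz; case: ifP => _ //=; rewrite subr0.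
Qed.

(** Both integers multiplying pi / n have the parity of j + 1, so their congruence modulo 2 n can be
    halved to one modulo n. *)
Lemma cis_crossing_angle (i : 'Z_n) (j : nat) a :
  cis (ray (s%:Z * (2 * a + 1) + (s%:Z - j.+1%:Z))) = cis (crossing_angle i j) <->
  (n %| s%:Z * (a + 1) - (j.+1)./2%:Z - (nat_of_ord i)%:Z)%Z.
Proof.
rewrite crossing_angleE cis_ray_eq.
have -> : j.+1%:Z = (odd j.+1)%:Z + 2 * (j.+1)./2%:Z.
  by have := odd_double_half j.+1; clear; lia.
move: (odd j.+1)%:Z (j.+1)./2%:Z (nat_of_ord i)%:Z => o h i'.
split=> [[k kE]|/dvdzP[k kE]].
  apply/dvdzP; exists k; apply: (@mulfI int 2) => //.
  have -> : 2 * (s%:Z * (a + 1) - h - i') =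
     s%:Z * (2 * a + 1) + (s%:Z - (o + 2 * h)) - (2 * i' - o) by ring.
  by rewrite kE; ring.
exists k; apply/eqP; rewrite -subr_eq0; apply/eqP.
have -> : n%:Z * k = k * n%:Z by ring.
by rewrite -kE; ring.
Qed.

(** a carries the left string and b the right one. They range over all integers, so that convenient
    representatives modulo n can be chosen. *)
Definition left_right_edges (i : 'Z_n) (j : nat) a b : Prop :=
  (n %| s%:Z * (b - a) - (s%:Z - j.+1%:Z))%Z /\
  (n %| s%:Z * (a + 1) - (j.+1)./2%:Z - (nat_of_ord i)%:Z)%Z.

Lemma circle_itv (j : 'I_s.-1) : 0 < s%:Z - j.+1%:Z < s%:Z.
Proof. by have := ltn_ord j; clear; lia. Qed.

Lemma left_rightP (i : 'Z_n) (j : 'I_s.-1) t u :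
  left_right i j t u <-> exists a b,
    [/\ 0 <= a < n%:Z, 0 <= b < n%:Z & left_right_edges i j a b] /\
    (t = edge_time a (lam (s%:Z - j.+1%:Z)) /\ u = edge_time b (lam (- (s%:Z - j.+1%:Z)))).
Proof.
have := circle_itv j; set D := s%:Z - j.+1%:Z => Djs.
have Ds : `|D| < s%:Z by move: Djs; clear; lia.
have lam_pos (D' : int) : `|D'| < s%:Z -> 0 < lam D' -> 0 < D'.
  by move=> D's; rewrite -lam0 lam_lt //; move: D's s0; clear; lia.
have polar a : edge_pt a (lam D) = (radius D)%:C%C * cis (ray (s%:Z * (2 * a + 1) + D)).
  exact: edge_pt_lam.
split=> [[dtu [[cP cardP] angP] nearer]|[a [b [[an bn [bD aD]] [-> ->]]]]].
  have [a [b [D' [[D'0 D's [an bn ab]] [tE uE]]]]] := double_ptP dtu.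
  (* Of the two opposite offsets at a crossing, arriving from nearer the center selects the positive
     one. *)
  have D'_gt0 : 0 < D'.
    apply: lam_pos => //; apply/(left_nearer a); first exact: lam_itv.
    by rewrite -tE.
  rewrite tE proj_edge_time ?lam_itvW // modulus_edge_pt_lam // in cardP angP.
  have D'E : D' = D.
    have D'_itv : 0 < D' < s%:Z by move: D's D'_gt0; clear; lia.
    exact: (card_larger_radii j D'_itv).1 cardP.
  rewrite D'E in tE uE ab angP.
  exists a, b; split=> //; split=> //; split=> //.
  apply/cis_crossing_angle; apply: (radius_inj_cis (radius_gt0 Ds)).
  by rewrite -angP polar.
have D0 : D != 0 by move: Djs; clear; lia.
have dtu := double_pt_lam D0 Ds (And3 an bn bD).
split=> //.
  rewrite /is_crossing /on_circle proj_edge_time ?lam_itvW // modulus_edge_pt_lam //.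
  split; last first.
    by rewrite polar; congr (_ * _); apply/cis_crossing_angle.
  split; last exact: (card_larger_radii j Djs).2.
  by do 2 eexists; split; [exact: dtu|rewrite proj_edge_time ?lam_itvW].
apply/left_nearer; first exact: lam_itv.
by rewrite -lam0 lam_lt //; move: Djs s0; clear; lia.
Qed.
Lemma edge_time_period k q tau : edge_time (k + n%:Z * q) tau = edge_time k tau + q%:~R.
Proof.
by rewrite /edge_time intrD intrM -[n%:Z%:~R]/(n%:R : R); field.
Qed.

Lemma left_right_edges_inj (i : 'Z_n) j a b a' b' :
  0 <= a < n%:Z -> 0 <= b < n%:Z -> 0 <= a' < n%:Z -> 0 <= b' < n%:Z ->
  left_right_edges i j a b -> left_right_edges i j a' b' -> a = a' /\ b = b'.
Proof.
move=> an bn a'n b'n [ab ai] [a'b' a'i]; have aa' : a = a'.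
  apply: (coprime_mul_inj hsn an a'n); have := rpredB ai a'i.
  by congr (_ %| _)%Z; ring.
split=> //; rewrite -aa' in a'b'.
apply: (coprime_mul_inj hsn bn b'n); have := rpredB ab a'b'.
by congr (_ %| _)%Z; ring.
Qed.

Lemma left_right_edges_mod (i : 'Z_n) j a b : left_right_edges i j a b ->
  left_right_edges i j (a %% n)%Z (b %% n)%Z.
Proof.
have aE := divz_eq a n; have bE := divz_eq b n.
move: (a %/ n)%Z (a %% n)%Z (b %/ n)%Z (b %% n)%Z aE bE => qa ra qb rb -> ->.
move=> [/dvdzP[x xE] /dvdzP[y yE]]; split; apply/dvdzP.
  exists (x - s%:Z * (qb - qa)); rewrite mulrBl -xE; ring.
exists (y - s%:Z * qa); rewrite mulrBl -yE; ring.
Qed.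

(** * Signs of the braid from the heights *)

Section HeightOrder.
Variables (m : nat) (phi : R).
Hypothesis knot : cylinder_knot s n m phi.

Let phase t : R := m%:R * t + phi.

Lemma height_lt t u :
  (height m phi u < height m phi t) = (cos (2 * pi * phase u) < cos (2 * pi * phase t)).
Proof. exact: sawtooth_lt. Qed.

Lemma double_pt_height t u : double_pt s n t u -> height m phi t != height m phi u.
Proof.
move=> [t01 u01 tu eqp]; apply: contra_neq tu => eqh.
by apply: knot.1 => //; rewrite /billiard_curve eqp eqh.
Qed.

(** Moving an edge by a multiple of n adds an integer to the parameter and to the phase, which the
    cosine ignores, so a and b need no range condition. The cosines differ because the knot has no
    self-intersections. *)
Lemma cylinder_braid_edges (i : 'Z_n) (j : 'I_s.-1) a b
    (D := s%:Z - j.+1%:Z) (x := phase (edge_time a (lam D)))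
    (y := phase (edge_time b (lam (- D)))) :
  left_right_edges i j a b ->
  cos (2 * pi * y) != cos (2 * pi * x) /\
  cylinder_braid s n m phi (i, j) = (cos (2 * pi * y) < cos (2 * pi * x)).
Proof.
have n_gt0z : 0 < n%:Z by rewrite ltz_nat -(ltr0n R).
have modn_itv c : 0 <= (c %% n)%Z < n%:Z by rewrite modz_ge0 ?ltz_pmod.
have phase_mod c tau :
    cos (2 * pi * phase (edge_time c tau)) =
    cos (2 * pi * phase (edge_time (c %% n)%Z tau)).
  have cE : c = (c %% n)%Z + n%:Z * (c %/ n)%Z by rewrite {1}(divz_eq c n) addrC mulrC.
  rewrite {1}cE edge_time_period -[RHS](cosDz2pi _ (m%:Z * (c %/ n)%Z)) intrM.
  by congr cos; rewrite /phase -[m%:Z%:~R]/(m%:R : R); ring.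
move=> /left_right_edges_mod ab; rewrite /x /y (phase_mod a) (phase_mod b).
move: (a %% n)%Z (b %% n)%Z (modn_itv a) (modn_itv b) ab => a' b' an bn ab.
have lr : left_right i j (edge_time a' (lam D)) (edge_time b' (lam (- D))).
  by apply/left_rightP; exists a', b'.
split.
  have [/double_pt_height + _ _] := lr; apply: contra_neq => eqc.
  by apply/le_anti; rewrite !leNgt !height_lt eqc ltxx.
rewrite ffunE /= -height_lt; apply/asboolP/idP => [[t [u []]]|hlt].
  move=> /left_rightP[a1 [b1 [[a1n b1n a1b1] [-> ->]]]].
  by have [<- <-] := left_right_edges_inj an bn a1n b1n ab a1b1.
by exists (edge_time a' (lam D)), (edge_time b' (lam (- D))).
Qed.

(** As z is an integer, rounding w down passes no multiple of n; this turns the real phase into an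
    integer one. *)
Lemma floor_divz (z : int) (w : R) :
  Num.floor ((z%:~R + w) / n%:R) = ((z + Num.floor w) %/ n)%Z.
Proof.
have n_gt0z : 0 < n%:Z by rewrite ltz_nat -(ltr0n R).
have /andP[w0 w1] := floor_itv w.
set q := (_ %/ _)%Z; apply: floor_def.
rewrite ler_pdivlMr // ltr_pdivrMr // -[n%:R]/(n%:Z%:~R : R) -!intrM.
have q0 : q * n%:Z <= z + Num.floor w by rewrite lez_floor.
have q1 : z + Num.floor w + 1 <= (q + 1) * n%:Z by rewrite lezD1 ltz_ceil.
move: q0 q1; rewrite -2!(ler_int R) !intrD => q0 q1.
by move: w0 w1 q0 q1; rewrite intrD; lra.
Qed.

Lemma mulr_lt0_addb (x y : R) : x != 0 -> y != 0 -> (x * y < 0) = (x < 0) (+) (y < 0).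
Proof.
case: (ltgtP x 0) => // x0 _; case: (ltgtP y 0) => // y0 _ /=.
- by rewrite ltNge ltW // nmulr_rgt0.
- by rewrite nmulr_rlt0.
- by rewrite pmulr_rlt0.
- by rewrite ltNge ltW // pmulr_rgt0.
Qed.

Lemma cylinder_braid_wave :
  exists C M p, cylinder_braid s n m phi = wave_array n s C M p.
Proof.
have [r [q rq]] := coprime_bezout hsn.
pose D (j : nat) : int := s%:Z - j.+1%:Z.
(* [T] is the factor sin (pi (x - y)), which depends on the circle alone; [psi] is chosen so that x
   + y = (m r X + psi) / n. *)
pose T (j : nat) := sin (pi * (m%:R * (lam (D j) - (r * D j)%:~R) / n%:R)).
pose psi : R := n%:R * (2 * phi - (m%:Z * q)%:~R).
exists (fun j => T j < 0), (m%:Z * r), (Num.floor psi).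
apply/ffunP => -[i j].
set X : int := 2 * (nat_of_ord i)%:Z - (odd j.+1)%:Z.
(* As r inverts s modulo n, this solves s (a + 1) = i + (j + 1)./2; adding r D leads to the edge of
   the right string. *)
pose a0 : int := r * ((nat_of_ord i)%:Z + (j.+1)./2%:Z) - 1.
have jE : j.+1%:Z = (odd j.+1)%:Z + 2 * (j.+1)./2%:Z.
  by have := odd_double_half j.+1; clear; lia.
have ab0 : left_right_edges i j a0 (a0 + r * D j).
  split; apply/dvdzP; rewrite -/(D j) /a0.
    exists (- q * D j); apply/eqP; rewrite -subr_eq0; apply/eqP.
    move: (D j) => D'; have -> : s%:Z = s%:Z * 1 by rewrite mulr1.
    transitivity (D' * (r * s%:Z + q * n%:Z - 1)); first by ring.
    by rewrite rq subrr mulr0.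
  move: (nat_of_ord i)%:Z (j.+1)./2%:Z => i' h.
  exists (- q * (i' + h)); apply/eqP; rewrite -subr_eq0; apply/eqP.
  transitivity ((i' + h) * (r * s%:Z + q * n%:Z - 1)); first by ring.
  by rewrite rq subrr mulr0.
(* Because r s = 1 - q n, the sum of the two edge indices depends on the crossing only through X. *)
have [a ab abE] : exists2 a : int, left_right_edges i j a (a + r * D j)
    & a + (a + r * D j) + 1 = r * X - n%:Z * q.
  exists a0 => //; rewrite /a0 /X /D jE.
  move: (nat_of_ord i)%:Z (odd _)%:Z (j.+1)./2%:Z => i' o h.
  apply/eqP; rewrite -subr_eq0; apply/eqP.
  transitivity (r * s%:Z + q * n%:Z - 1); first by ring.
  by rewrite rq subrr.
have [] := cylinder_braid_edges ab; rewrite -/(D j).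
set y := phase _; set x := phase _ => cxy ->.
have sumE : x + y = ((m%:Z * r * X)%:~R + psi) / n%:R.
  have -> : x + y = m%:R * (a + (a + r * D j) + 1)%:~R / n%:R + 2 * phi.
    rewrite /x /y /phase /edge_time lamN !intrD intrM.
    by move: (lam _) => l; field.
  rewrite abE /psi !(intrD, intrM, mulrNz) -[n%:Z%:~R]/(n%:R : R) -[m%:Z%:~R]/(m%:R : R).
  by field.
have diffE : x - y = m%:R * (lam (D j) - (r * D j)%:~R) / n%:R.
  rewrite /x /y /phase /edge_time lamN !intrD intrM.
  by move: (lam _) => l; field.
have prodE : cos (2 * pi * y) - cos (2 * pi * x) = 2 * (sin (pi * (x + y)) * T j).
  rewrite cosB_sin /T -diffE.
  have -> : (2 * pi * y + 2 * pi * x) / 2 = pi * (x + y) by move: (pi : R) => p; field.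
  have -> : (2 * pi * y - 2 * pi * x) / 2 = - (pi * (x - y)) by move: (pi : R) => p; field.
  by rewrite sinN; ring.
(* Distinct heights at the crossing keep both sines nonzero, so that each has a definite sign. *)
have : sin (pi * (x + y)) * T j != 0.
  apply: contra_neq cxy => prod0; apply/eqP.
  by rewrite -subr_eq0 prodE prod0 mulr0.
rewrite mulf_eq0 negb_or => /andP[S0 T0].
rewrite ffunE /= -subr_lt0 prodE pmulr_rlt0 // mulr_lt0_addb // addbC.
by congr (_ (+) _); rewrite sin_pi_lt0 // sumE floor_divz.
Qed.

End HeightOrder.
End Crossings.

(** * The bound for s = 1, s = 2 and s >= 3 *)

Theorem theorem4p3 (R : realType) (s n : nat) (hs : (1 <= s)%N) (hn : (1 <= n)%N)
    (hsn : coprime s n) (hn2s : (2 * s + 1 <= n)%N) :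
  ((num_cylinder_braids R s n)%:R <= n.+1%:R * 2%:R ^ (s%:Z - 3) :> rat)%R.
Proof.
have n1 : (1 < n)%N by lia.
have B_wave : {in cylinder_braids R s n, forall e, exists C M p, e = wave_array n s C M p}.
  move=> e; rewrite inE => /asboolP[m [phi [_ knot ->]]].
  exact: (cylinder_braid_wave hs hn2s hsn knot).
rewrite /num_cylinder_braids.
case: s hs hsn hn2s B_wave => [//|[|[|s]]] _ sn n2s B_wave.
(* Without crossings there is a single sign array, and 1 <= (n + 1) / 4 as n >= 3. *)
- have le1 : (#|equivalence_partition (@braid_equiv 1 n) (cylinder_braids R 1 n)| <= 1)%N.
    rewrite -[X in (_ <= X)%N]card_unit.
    apply: (card_equivalence_partition_le (f := fun=> [ffun=> true]) (@braid_equiv_sym n 1)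
      (@braid_equiv_trans n 1)) => e _; exists tt.
    rewrite (_ : [ffun=> true] = e); first exact: connect0.
    by apply/ffunP => -[i []].
  apply: (@le_trans _ _ 1); first by rewrite (ler_nat _ _ 1).
  rewrite -[1%:Z - 3]/(- 2%:Z) -exprnN ler_pdivlMr // mul1r -natrX ler_nat; lia.
- have := @card_wave_classes n 2 _ n1 isT B_wave; rewrite expn0 muln1 => le1.
  rewrite -[2%:Z - 3]/(- 1%:Z) -(exprnN _ 1) expr1 ler_pdivlMr // -natrM ler_nat.
  (* n is coprime to 2, so n./2 + 1 = (n + 1) / 2. *)
  have odd_n : odd n by rewrite -coprime2n.
  have := odd_double_half n; rewrite odd_n; lia.
have -> : s.+3%:Z - 3 = s%:Z by lia.
rewrite -exprnP -natrX -natrM ler_nat.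
(* Here s is the original parameter less 3. For odd n the count is (n./2 + 1) * 2 * 2^s, for even n
   it is n./2 * 2 * 2^s + 2^s; both equal (n + 1) * 2^s. *)
have pow2 : (2 ^ (s.+3 - 2) = 2 * 2 ^ s)%N by rewrite subSS subSS subn0 expnS.
have := odd_double_half n; case odd_n : (odd n) => nE.
  have := @card_wave_classes n s.+3 _ n1 isT B_wave; rewrite pow2; nia.
have := @card_wave_classes_even n s.+3 _ n1 isT B_wave (negbT odd_n) isT.
rewrite pow2 !subSS subn0; nia.
Qed.
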